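(* For every universal first-order sentence $\sigma$ in the language of specialization semilattices, the following conditions are equivalent. (1) The sentence $\sigma$ is true in all the models of the form $\mathbf S(X)$, where $X$ varies among topological spaces. (2) The sentence $\sigma$ is true in all the models of the form $\mathbf S(X)$, where $X$ varies among closure spaces. (3) The sentence $\sigma$ is true in all the models of the form $\mathbf S(P)$, where $P$ varies among closure semilattices. (4) The sentence $\sigma$ is a logical consequence of the theory of specialization semilattices.
   Context: The language of specialization semilattices is $\{\vee, \sqsubseteq\}$, with $\vee$ a binary operation and $\sqsubseteq$ a binary relation. Semilattices are join-semilattices, with induced order $a \leq b$ iff $a \vee b = b$. The theory of specialization semilattices is the universal first-order theory axiomatized by the semilattice axioms for $\vee$ and by (S1) $a \leq b$ implies $a \sqsubseteq b$; (S2) $a \sqsubseteq b$ and $b \sqsubseteq c$ imply $a \sqsubseteq c$; (S3) $a \sqsubseteq b$ and $a_1 \sqsubseteq b$ imply $a \vee a_1 \sqsubseteq b$ (for all $a,b,c,a_1$). A closure space is a set $X$ with a family of subsets (called closed) that contains $X$ and is closed under arbitrary intersections; $K$ denotes the associated closure operator ($Ka$ is the intersection of all closed sets containing $a$). A closure semilattice is a triple $(P, \vee, K)$ with $(P, \vee)$ a semilattice and $K : P \to P$ a closure operation: isotone ($a \leq b$ implies $Ka \leq Kb$), inflationary ($a \leq Ka$) and idempotent ($KKa = Ka$). If $X$ is a topological space or a closure space, $\mathbf S(X) = (\mathcal P(X), \cup, \sqsubseteq)$ where $a \sqsubseteq b$ means $a \subseteq Kb$. If $P$ is a closure semilattice,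 $\mathbf S(P) = (P, \vee, \sqsubseteq)$ where $a \sqsubseteq b$ means $a \leq Kb$. *)

(* Defs.v *)
From HB Require Import structures.
From mathcomp Require Import all_boot all_order.
From mathcomp Require Import classical_sets topology_structure.

Set Implicit Arguments.
Unset Strict Implicit.
Unset Printing Implicit Defensive.

Local Open Scope classical_set_scope.
Local Open Scope order_scope.

(** First-order syntax over the language {\/, sqsubseteq}, with equality and
    variables named by natural numbers. *)

Inductive term : Type :=
| Var of nat
| Join of term & term.

Inductive formula : Type :=
| FEq of term & term
| FSpec of term & term
| FFalse
| FNot of formula
| FAnd of formula & formula
| FOr of formula & formula
| FImp of formula & formula
| FAll of nat & formula
| FEx of nat & formula.

Fixpoint term_fv (t : term) : seq nat :=
  match t with
  | Var x => [:: x]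
  | Join s t => term_fv s ++ term_fv t
  end.

Fixpoint fv (phi : formula) : seq nat :=
  match phi with
  | FEq s t | FSpec s t => term_fv s ++ term_fv t
  | FFalse => [::]
  | FNot p => fv p
  | FAnd p q | FOr p q | FImp p q => fv p ++ fv q
  | FAll x p | FEx x p => [seq y <- fv p | y != x]
  end.

Definition sentence (phi : formula) : Prop := fv phi = [::].

Fixpoint quantifier_free (phi : formula) : bool :=
  match phi with
  | FEq _ _ | FSpec _ _ | FFalse => true
  | FNot p => quantifier_free p
  | FAnd p q | FOr p q | FImp p q => quantifier_free p && quantifier_free q
  | FAll _ _ | FEx _ _ => false
  end.

(** Universal formulas are prenex: a block of universal quantifiers, possibly
    empty, followed by a quantifier-free formula. *)
Fixpoint universal (phi : formula) : bool :=
  match phi with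
  | FAll _ p => universal p
  | _ => quantifier_free phi
  end.

Definition universal_sentence (phi : formula) : Prop :=
  universal phi /\ sentence phi.

(** As usual in first-order logic, structures have nonempty domains. *)
Record sstructure : Type := SStructure {
  sdom :> Type;
  sdom_nonempty : inhabited sdom;
  sjoin : sdom -> sdom -> sdom;
  sspec : sdom -> sdom -> Prop
}.

Fixpoint eval (M : sstructure) (v : nat -> M) (t : term) : M :=
  match t with
  | Var x => v x
  | Join s t => sjoin (eval v s) (eval v t)
  end.

Fixpoint sat (M : sstructure) (v : nat -> M) (phi : formula) : Prop :=
  match phi with
  | FEq s t => eval v s = eval v t
  | FSpec s t => sspec (eval v s) (eval v t)
  | FFalse => False
  | FNot p => ~ sat v p
  | FAnd p q => sat v p /\ sat v q
  | FOr p q => sat v p \/ sat v q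
  | FImp p q => sat v p -> sat v q
  | FAll x p => forall a : M, sat [eta v with x |-> a] p
  | FEx x p => exists a : M, sat [eta v with x |-> a] p
  end.

(** For a sentence the choice of the assignment is immaterial. *)
Definition true_in (M : sstructure) (phi : formula) : Prop :=
  forall v : nat -> M, sat v phi.

Definition logical_consequence (T : set formula) (phi : formula) : Prop :=
  forall M : sstructure,
    (forall psi : formula, T psi -> true_in M psi) -> true_in M phi.

(** [a <= b] is an abbreviation for [a \/ b = b]. *)
Definition FLe (s t : term) : formula := FEq (Join s t) t.

Inductive spec_semilattice_theory : set formula :=
| ax_joinA : spec_semilattice_theory
    (FAll 0 (FAll 1 (FAll 2
      (FEq (Join (Var 0) (Join (Var 1) (Var 2)))
           (Join (Join (Var 0) (Var 1)) (Var 2))))))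
| ax_joinC : spec_semilattice_theory
    (FAll 0 (FAll 1 (FEq (Join (Var 0) (Var 1)) (Join (Var 1) (Var 0)))))
| ax_joinxx : spec_semilattice_theory
    (FAll 0 (FEq (Join (Var 0) (Var 0)) (Var 0)))
| ax_S1 : spec_semilattice_theory
    (FAll 0 (FAll 1 (FImp (FLe (Var 0) (Var 1)) (FSpec (Var 0) (Var 1)))))
| ax_S2 : spec_semilattice_theory
    (FAll 0 (FAll 1 (FAll 2
      (FImp (FAnd (FSpec (Var 0) (Var 1)) (FSpec (Var 1) (Var 2)))
            (FSpec (Var 0) (Var 2))))))
| ax_S3 : spec_semilattice_theory
    (FAll 0 (FAll 1 (FAll 2
      (FImp (FAnd (FSpec (Var 0) (Var 1)) (FSpec (Var 2) (Var 1)))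
            (FSpec (Join (Var 0) (Var 2)) (Var 1)))))).

Record closureSpace : Type := ClosureSpace {
  cs_sort :> Type;
  cs_closed : set (set cs_sort);
  cs_closedT : cs_closed setT;
  cs_closedI : forall F : set (set cs_sort),
    F `<=` cs_closed -> cs_closed (\bigcap_(C in F) C)
}.

(** [smallest C A] is the intersection of all the members of [C]
    containing [A]. *)
Definition cs_closure (X : closureSpace) (A : set X) : set X :=
  smallest (@cs_closed X) A.

Record closureSemilattice (d : Order.disp_t) : Type := ClosureSemilattice {
  csl_sort :> joinSemilatticeType d;
  csl_nonempty : inhabited csl_sort;
  csl_closure : csl_sort -> csl_sort;
  csl_isotone : forall a b, a <= b -> csl_closure a <= csl_closure b;
  csl_inflationary : forall a, a <= csl_closure a;
  csl_idempotent : forall a, csl_closure (csl_closure a) = csl_closure a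
}.

Definition S_powerset (X : Type) (K : set X -> set X) : sstructure :=
  @SStructure (set X) (inhabits set0) (fun A B => (A `|` B)%classic)
    (fun A B => A `<=` K B).

Definition S_top (X : topologicalType) : sstructure :=
  S_powerset (@closure X).

Definition S_closure_space (X : closureSpace) : sstructure :=
  S_powerset (@cs_closure X).

Definition S_closure_semilattice (d : Order.disp_t) (P : closureSemilattice d) :
    sstructure :=
  @SStructure P (csl_nonempty P) (fun a b => a `|` b)
    (fun a b => a <= csl_closure b).

(* Main.v *)
Require Import Defs.
From HB Require Import structures.
From mathcomp Require Import all_boot all_order.
From mathcomp Require Import boolp classical_sets topology_structure.

(** The substance of the theorem is that (1) implies (4), and this holds because
    every specialization semilattice [M] embeds into [S_top X] for a suitable
    space [X]; universal sentences pass from a structure to the structures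
    embedded in it.

    The points of [X] are [Spoint b] and [Opoint b] for [b] in [M], together
    with one point [Generic].  An element [a] is sent to the set of the
    [Spoint b] such that not [a ⊑ b], of the [Opoint b] such that not
    [a <= b], and of [Generic].  Since [{a | a ⊑ b}] and [{a | a <= b}] are
    ideals, joins go to unions.  The points [Opoint b] separate the elements
    of [M], and the topology is chosen so that they have no influence on the
    relation ⊑: every neighbourhood of [Opoint b] contains [Generic], so that
    [Opoint b] lies in the closure of all the images.  The points [Spoint b],
    on the other hand, are isolated, and they detect exactly ⊑, because a
    preorder is determined by its principal down-sets.  [Generic] is needed
    because of a possible least element, whose image would otherwise be empty
    and have empty closure.

    The other implications are general.  A closure semilattice satisfies the
    axioms; the powerset of a closure space with its closure is a closure
    semilattice; a topological space is a closure space whose closed sets are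
    the topologically closed ones.  These give (4) => (3) => (2) => (1). *)

Set Implicit Arguments.
Unset Strict Implicit.
Unset Printing Implicit Defensive.

Import Order.LTheory.

Local Open Scope classical_set_scope.

(** * Embeddings and universal sentences *)

Record embedding (M N : sstructure) (f : M -> N) : Prop := Embedding {
  embedding_inj : injective f;
  embedding_join : forall a b, f (sjoin a b) = sjoin (f a) (f b);
  embedding_spec : forall a b, sspec a b <-> sspec (f a) (f b)
}.

Section Embedding.
Variables (M N : sstructure) (f : M -> N).
Hypothesis fE : embedding f.

Lemma eval_embedding (v : nat -> M) (t : term) :
  eval (f \o v) t = f (eval v t).
Proof. by elim: t => //= s -> t ->; rewrite embedding_join. Qed.

Lemma sat_quantifier_free_embedding (v : nat -> M) (phi : formula) :
  quantifier_free phi -> sat (f \o v) phi <-> sat v phi.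
Proof.
elim: phi => //=.
- by move=> s t _; rewrite !eval_embedding; split=> [/(embedding_inj fE)|->].
- by move=> s t _; rewrite !eval_embedding -(embedding_spec fE).
- by move=> p IHp /IHp ->.
- by move=> p IHp q IHq /andP[/IHp -> /IHq ->].
- by move=> p IHp q IHq /andP[/IHp -> /IHq ->].
- by move=> p IHp q IHq /andP[/IHp -> /IHq ->].
Qed.

(** Only this direction survives the quantifiers: a universal quantifier over
    [N] may be instantiated at the image of [f], but [f] need not be onto. *)
Lemma sat_universal_embedding (phi : formula) : universal phi ->
  forall v : nat -> M, sat (f \o v) phi -> sat v phi.
Proof.
elim: phi => [s t|s t||p _|p _ q _|p _ q _|p _ q _|x p IHp|x p _] phiU v;
  try by move/(sat_quantifier_free_embedding v phiU).
move=> vp a; apply: IHp => //; have := vp (f a).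
congr (sat _ p); apply: funext => y /=.
by case: ifP.
Qed.

Lemma true_in_embedding (phi : formula) :
  universal phi -> true_in N phi -> true_in M phi.
Proof. by move=> phiU Nphi v; apply: sat_universal_embedding. Qed.

End Embedding.

(** * Specialization semilattices *)

Record spec_semilattice (M : sstructure) : Prop := SpecSemilattice {
  sjoinA : associative (@sjoin M);
  sjoinC : commutative (@sjoin M);
  sjoinxx : idempotent_op (@sjoin M);
  sspec_le : forall a b : M, sjoin a b = b -> sspec a b;
  sspec_trans : forall a b c : M, sspec a b -> sspec b c -> sspec a c;
  sspec_join : forall a b c : M, sspec a b -> sspec c b -> sspec (sjoin a c) b
}.

Lemma spec_semilattice_theoryP (M : sstructure) :
  (forall psi, spec_semilattice_theory psi -> true_in M psi) <->
  spec_semilattice M.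
Proof.
split=> [MT|[jA jC jxx S1 S2 S3] psi].
  have [v0] : inhabited (nat -> M) by case: (sdom_nonempty M) => m; split.
  split.
  - by move=> a b c; exact: (MT _ ax_joinA v0 a b c).
  - by move=> a b; exact: (MT _ ax_joinC v0 a b).
  - by move=> a; exact: (MT _ ax_joinxx v0 a).
  - by move=> a b; exact: (MT _ ax_S1 v0 a b).
  - by move=> a b c ab bc; exact: (MT _ ax_S2 v0 a b c (conj ab bc)).
  - by move=> a b c ab cb; exact: (MT _ ax_S3 v0 a b c (conj ab cb)).
case=> v /=.
- by move=> a b c; exact: jA.
- by move=> a b; exact: jC.
- by move=> a; exact: jxx.
- by move=> a b; exact: S1.
- by move=> a b c [ab bc]; exact: S2 ab bc.
- by move=> a b c [ab cb]; exact: S3.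
Qed.

Section SpecSemilatticeTheory.
Variable M : sstructure.
Hypothesis MS : spec_semilattice M.
Implicit Types a b c : M.

Lemma sspec_refl a : sspec a a.
Proof. by apply: (sspec_le MS); exact: (sjoinxx MS). Qed.

Lemma sspec_joinE a b c : sspec (sjoin a b) c <-> sspec a c /\ sspec b c.
Proof.
split=> [abc|[ac bc]]; last exact: (sspec_join MS).
split; apply: (sspec_trans MS) abc; apply: (sspec_le MS).
- by rewrite (sjoinA MS) (sjoinxx MS).
- by rewrite (sjoinC MS a) (sjoinA MS) (sjoinxx MS).
Qed.

Lemma sle_joinE a b c :
  sjoin (sjoin a b) c = c <-> sjoin a c = c /\ sjoin b c = c.
Proof.
split=> [<-|[ac bc]]; last by rewrite -(sjoinA MS) bc.
split; first by rewrite !(sjoinA MS) (sjoinxx MS).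
by rewrite (sjoinC MS a) !(sjoinA MS) (sjoinxx MS).
Qed.

End SpecSemilatticeTheory.

(** * The space of a specialization semilattice *)

Inductive spec_point (M : sstructure) : Type :=
| Spoint of M
| Opoint of M
| Generic.

Arguments Generic {M}.

Section SpecSpace.
Variable M : sstructure.

HB.instance Definition _ := gen_eqMixin (spec_point M).
HB.instance Definition _ := gen_choiceMixin (spec_point M).

(** The topology in which the points [Spoint b] and [Generic] are isolated and
    [Opoint b] has [{Opoint b, Generic}] as its least neighbourhood. *)
Definition spec_open (U : set (spec_point M)) : Prop :=
  forall b, U (Opoint b) -> U Generic.

Lemma spec_openT : spec_open setT.
Proof. by []. Qed.

Lemma spec_openI : setI_closed spec_open.
Proof. by move=> U V Uo Vo b [/Uo UG /Vo VG]; split. Qed.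

Lemma spec_open_bigU (I : Type) (F : I -> set (spec_point M)) :
  (forall i, spec_open (F i)) -> spec_open (\bigcup_i F i).
Proof. by move=> Fo b [i _ /Fo FG]; exists i. Qed.

HB.instance Definition _ :=
  isOpenTopological.Build (spec_point M) spec_openT spec_openI spec_open_bigU.

Lemma closure_Spoint (A : set (spec_point M)) b :
  closure A (Spoint b) -> A (Spoint b).
Proof.
have bo : open [set Spoint b] by move=> c /=.
by move=> /(_ _ (open_nbhs_nbhs (conj bo erefl))) [x [Ax xb]]; rewrite -xb.
Qed.

Lemma closure_Opoint (A : set (spec_point M)) b :
  A Generic -> closure A (Opoint b).
Proof.
move=> AG U; rewrite nbhsE => -[V [Vo Vb] VU].
by exists Generic; split=> //; apply: VU; apply: Vo Vb.
Qed.

Definition spec_image (a : M) : set (spec_point M) := fun x =>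
  match x with
  | Spoint b => ~ sspec a b
  | Opoint b => sjoin a b <> b
  | Generic => True
  end.

Hypothesis MS : spec_semilattice M.

Lemma spec_image_inj : injective spec_image.
Proof.
(* The points [Opoint b] recover the order from the images. *)
have le a b : spec_image a = spec_image b -> sjoin a b = b.
  move=> eq_ab; apply: contrapT => /= nab.
  have : spec_image a (Opoint b) by [].
  by rewrite eq_ab /=; apply; exact: (sjoinxx MS).
by move=> a b eq_ab; rewrite -(le a b) // (sjoinC MS) le.
Qed.

Lemma spec_image_join a b :
  spec_image (sjoin a b) = spec_image a `|` spec_image b.
Proof.
apply: funext => -[c|c|] /=; rewrite /setU /mkset /=; apply: propext.
- by rewrite (sspec_joinE MS) not_andP.
- by rewrite (sle_joinE MS) not_andP.
- by split=> // _; left.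
Qed.

Lemma sspec_spec_image a b :
  sspec a b <-> spec_image a `<=` closure (spec_image b).
Proof.
split=> [ab [c|c|] /= ac|ab].
- by apply: subset_closure => /= bc; apply: ac; exact: (sspec_trans MS) bc.
- exact: closure_Opoint.
- exact: subset_closure.
(* If not [a ⊑ b], the isolated point [Spoint b] belongs to the image of [a]
   but not to the image of [b]. *)
apply: contrapT => nab; have /closure_Spoint := ab (Spoint b) nab.
by apply; exact: sspec_refl.
Qed.

Lemma spec_image_embedding :
  @embedding M (S_top (spec_point M)) spec_image.
Proof.
by split; [exact: spec_image_inj | exact: spec_image_join
  | exact: sspec_spec_image].
Qed.

End SpecSpace.

(** * Closure semilattices and closure spaces *)

Lemma closure_semilattice_spec (d : Order.disp_t) (P : closureSemilattice d) :
  spec_semilattice (S_closure_semilattice P).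
Proof.
split=> /=.
- exact: joinA.
- exact: joinC.
- exact: joinxx.
- move=> a b abb; apply: le_trans (csl_inflationary b).
  by rewrite -abb leUl.
- move=> a b c ab /(@csl_isotone _ P); rewrite csl_idempotent.
  exact: le_trans.
- by move=> a b c ab cb; rewrite leUx ab.
Qed.

Section PowersetSemilattice.
Variable X : closureSpace.
Local Notation K := (@cs_closure X).

Lemma cs_closed_closure A : cs_closed (K A).
Proof. by apply: cs_closedI => C []. Qed.

Lemma cs_closure_isotone (A B : set X) : (A <= B)%O -> (K A <= K B)%O.
Proof.
by rewrite !subsetEset; apply: sub_smallest2r; exact: cs_closed_closure.
Qed.

Lemma cs_closure_inflationary (A : set X) : (A <= K A)%O.
Proof. by rewrite subsetEset; exact: sub_gen_smallest. Qed.

Lemma cs_closure_idempotent (A : set X) : K (K A) = K A.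
Proof. exact/smallest_id/cs_closed_closure. Qed.

Definition powerset_semilattice : closureSemilattice set_display :=
  @ClosureSemilattice set_display (set X) (inhabits set0) K
    cs_closure_isotone cs_closure_inflationary cs_closure_idempotent.

Lemma powerset_semilattice_embedding :
  @embedding (S_closure_space X) (S_closure_semilattice powerset_semilattice)
    id.
Proof. by split=> //= A B; rewrite subsetEset. Qed.

End PowersetSemilattice.

Section TopClosureSpace.
Variable X : topologicalType.

Definition top_closure_space : closureSpace :=
  @ClosureSpace X (@closed X) closedT
    (fun F => @closed_bigI X _ F id).

Lemma top_closure_space_embedding :
  @embedding (S_top X) (S_closure_space top_closure_space) id.
Proof. by split=> //= A B; rewrite closureE. Qed.

End TopClosureSpace.

(** * The equivalence *)

Theorem corollary5p8 (sigma : formula) (hsigma : universal_sentence sigma) :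
  [<-> (forall X : topologicalType, true_in (S_top X) sigma);
       (forall X : closureSpace, true_in (S_closure_space X) sigma);
       (forall (d : Order.disp_t) (P : closureSemilattice d),
          true_in (S_closure_semilattice P) sigma);
       logical_consequence spec_semilattice_theory sigma].
Proof.
case: hsigma => sigmaU _.
have top_lc : (forall X : topologicalType, true_in (S_top X) sigma) ->
    logical_consequence spec_semilattice_theory sigma.
  move=> topS M /spec_semilattice_theoryP MS.
  exact: (true_in_embedding (spec_image_embedding MS) sigmaU (topS _)).
have lc_csl : logical_consequence spec_semilattice_theory sigma ->
    forall d (P : closureSemilattice d),
      true_in (S_closure_semilattice P) sigma.
  move=> lcS d P; apply/lcS/spec_semilattice_theoryP.
  exact: closure_semilattice_spec.
have csl_cs : (forall d (P : closureSemilattice d),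
      true_in (S_closure_semilattice P) sigma) ->
    forall X : closureSpace, true_in (S_closure_space X) sigma.
  move=> cslS X.
  exact: (true_in_embedding (powerset_semilattice_embedding X) sigmaU
    (cslS _ _)).
have cs_top : (forall X : closureSpace, true_in (S_closure_space X) sigma) ->
    forall X : topologicalType, true_in (S_top X) sigma.
  move=> csS X.
  exact: (true_in_embedding (top_closure_space_embedding X) sigmaU (csS _)).
tfae.
- by move=> /top_lc /lc_csl /csl_cs.
- by move=> /cs_top /top_lc /lc_csl.
- by move=> /csl_cs /cs_top /top_lc.
- by move=> /lc_csl /csl_cs /cs_top.
Qed.
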